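(* Let $\mathcal X$, $\mathcal C$, $h$, $D_h$ be as in the context and let $f:\mathcal X\to\mathbb R$ be differentiable on $\mathcal C$. Assume there exists $\mu>0$ such that, for every $x\in\mathcal C$ and $y\in\mathcal X$, $$f(y)\ge f(x)+\langle\nabla f(x),y-x\rangle+\mu D_h(y,x).$$ Let $x^\star\in\operatorname{argmin}_{x\in\mathcal X}f(x)$, let $x_0\in\mathcal C$ with $D_h(x^\star,x_0)<\infty$, let $\eta_k>0$, and let $(x_k)_{k\ge0}\subset\mathcal C$ satisfy $$x_{k+1}\in\operatorname*{argmin}_{x\in\mathcal X}\Bigl\{f(x)+\frac1{\eta_k}D_h(x,x_k)\Bigr\},\qquad k\ge0.$$ Then every step satisfies $$(1+\eta_k\mu)D_h(x^\star,x_{k+1})+D_h(x_{k+1},x_k)\le D_h(x^\star,x_k).$$ Hence, for every $K\ge0$, $$D_h(x^\star,x_{K+1})\le\Bigl(\prod_{k=0}^K\frac1{1+\eta_k\mu}\Bigr)D_h(x^\star,x_0).$$ For a constant stepsize $\eta_k\equiv\eta>0$, the contraction factor is $q=\frac1{1+\eta\mu}\in(0,1)$. If (with constant stepsize) $h$ is uniformly strongly convex on a convex region containing $x^\star$ and the iterates, then $x_k\to x^\star$ linearly in norm as well, i.e. there are $C\ge0$ and $\rho\in(0,1)$ with $\|x_k-x^\star\|\le C\rho^k$ for all $k$.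
   Context: $\mathcal X$ is a nonempty closed convex set in a finite-dimensional Euclidean space and $\mathcal C=\operatorname{ri}(\mathcal X)$ is its relative interior. All derivatives are taken along directions of the affine hull $\operatorname{aff}(\mathcal X)$: for $\varphi$ differentiable on $\mathcal C$, $\nabla\varphi(x)$ is the vector in the direction space of $\operatorname{aff}(\mathcal X)$ representing the derivative for the Euclidean inner product. $h:\mathcal C\to\mathbb R$ is a $C^2$ Legendre function (strictly convex, with $\|\nabla h(x_j)\|\to\infty$ whenever $x_j\in\mathcal C$ tends to a point of $\mathcal X\setminus\mathcal C$), extended continuously to those points of $\mathcal X\setminus\mathcal C$ used as comparison points. For $x\in\mathcal X$, $y\in\mathcal C$, $D_h(x,y)=h(x)-h(y)-\langle\nabla h(y),x-y\rangle$; at a boundary point $x$ this is finite when the (finite) continuous extension $h(x)$ exists. *)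

(* Defs.v *)
From HB Require Import structures.
From mathcomp Require Import all_boot all_order all_algebra.
From mathcomp Require Import all_classical all_reals all_analysis.
Set Implicit Arguments.
Unset Strict Implicit.
Unset Printing Implicit Defensive.
Import Order.TTheory GRing.Theory Num.Theory.
Import numFieldNormedType.Exports.
Local Open Scope classical_set_scope.
Local Open Scope ring_scope.

(* The ambient Euclidean space is 'rV[R]_n with the inner product [dot].  The
   library norm on 'rV[R]_n is the sup norm; it is used only for its topology,
   which is the Euclidean one.  All metric statements use [enorm]. *)
Definition dot (R : realType) (n : nat) (u v : 'rV[R]_n) : R :=
  \sum_(i < n) u 0 i * v 0 i.

Definition enorm (R : realType) (n : nat) (u : 'rV[R]_n) : R :=
  Num.sqrt (dot u u).

Definition affine_set (R : realType) (n : nat) (A : set 'rV[R]_n) : Prop :=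
  forall (x y : 'rV[R]_n) (t : R), A x -> A y -> A (t *: x + (1 - t) *: y).

Definition aff (R : realType) (n : nat) (X : set 'rV[R]_n) : set 'rV[R]_n :=
  smallest (@affine_set R n) X.

Definition aff_dir (R : realType) (n : nat) (X : set 'rV[R]_n) :
    set 'rV[R]_n :=
  [set v | exists a b, [/\ aff X a, aff X b & v = a - b]].

Definition ri (R : realType) (n : nat) (X : set 'rV[R]_n) : set 'rV[R]_n :=
  [set x | aff X x /\ \forall y \near x, aff X y -> X y].

(* Frechet derivative relative to aff X at x in ri X, represented by a vector
   of the direction space; such a vector is unique. *)
Definition is_rgrad (R : realType) (n : nat) (X : set 'rV[R]_n)
    (phi : 'rV[R]_n -> R) (x g : 'rV[R]_n) : Prop :=
  aff_dir X g /\
  forall e : R, 0 < e ->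
    \forall y \near x, ri X y ->
      `|phi y - phi x - dot g (y - x)| <= e * enorm (y - x).

Definition rdifferentiable (R : realType) (n : nat) (X : set 'rV[R]_n)
    (phi : 'rV[R]_n -> R) (x : 'rV[R]_n) : Prop :=
  exists g, is_rgrad X phi x g.

Definition rgrad (R : realType) (n : nat) (X : set 'rV[R]_n)
    (phi : 'rV[R]_n -> R) (x : 'rV[R]_n) : 'rV[R]_n :=
  xget 0 (is_rgrad X phi x).

(* H represents the derivative of F at x along aff X, acting on row vectors by
   v |-> v *m H.  Only its restriction to the direction space is determined. *)
Definition is_rjacobian (R : realType) (n : nat) (X : set 'rV[R]_n)
    (F : 'rV[R]_n -> 'rV[R]_n) (x : 'rV[R]_n) (H : 'M[R]_n) : Prop :=
  forall e : R, 0 < e ->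
    \forall y \near x, ri X y ->
      enorm (F y - F x - (y - x) *m H) <= e * enorm (y - x).

(* Asking for a continuous family of matrices is no loss of generality: a
   continuous Hessian on the direction space becomes one after composition with
   the orthogonal projection. *)
Definition relC2 (R : realType) (n : nat) (X : set 'rV[R]_n)
    (phi : 'rV[R]_n -> R) : Prop :=
  (forall x, ri X x -> rdifferentiable X phi x) /\
  exists H : 'rV[R]_n -> 'M[R]_n,
    (forall x, ri X x -> is_rjacobian X (rgrad X phi) x (H x)) /\
    {within ri X, continuous H}.

Definition strictly_convex_on (R : realType) (n : nat) (A : set 'rV[R]_n)
    (phi : 'rV[R]_n -> R) : Prop :=
  forall (x y : 'rV[R]_n) (t : R), A x -> A y -> x != y -> 0 < t < 1 ->
    phi (t *: x + (1 - t) *: y) < t * phi x + (1 - t) * phi y.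

Definition legendre (R : realType) (n : nat) (X : set 'rV[R]_n)
    (h : 'rV[R]_n -> R) : Prop :=
  strictly_convex_on (ri X) h /\
  forall (z : nat -> 'rV[R]_n) (p : 'rV[R]_n),
    (forall j, ri X (z j)) -> X p -> ~ ri X p -> z @ \oo --> p ->
    enorm (rgrad X h (z j)) @[j --> \oo] --> +oo.

(* Continuous extension of h from ri X to X: only the values of h on ri X
   matter, and the extension is +oo at the points of X \ ri X where h has no
   finite limit along ri X. *)
Definition hext (R : realType) (n : nat) (X : set 'rV[R]_n)
    (h : 'rV[R]_n -> R) (x : 'rV[R]_n) : \bar R :=
  if x \in ri X then (h x)%:E
  else if `[< cvg (h @ within (ri X) (nbhs x)) >]
       then (lim (h @ within (ri X) (nbhs x)))%:E
       else +oo%E.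

Definition bregman (R : realType) (n : nat) (X : set 'rV[R]_n)
    (h : 'rV[R]_n -> R) (x y : 'rV[R]_n) : \bar R :=
  (hext X h x - (h y + dot (rgrad X h y) (x - y))%:E)%E.

Definition argmin (T : Type) (d : Order.disp_t) (U : porderType d)
    (A : set T) (F : T -> U) : set T :=
  [set x | A x /\ forall y, A y -> (F x <= F y)%O].

(* Strong convexity on A, included in X, with a single modulus, for h extended
   to X. *)
Definition strongly_convex_on (R : realType) (n : nat) (X : set 'rV[R]_n)
    (h : 'rV[R]_n -> R) (A : set 'rV[R]_n) : Prop :=
  exists2 s : R, 0 < s &
    forall (x y : 'rV[R]_n) (t : R), A x -> A y -> 0 <= t <= 1 ->
      (hext X h (t *: x + (1 - t) *: y)
         + (s / 2 * t * (1 - t) * enorm (x - y) ^+ 2)%:E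
       <= t%:E * hext X h x + (1 - t)%:E * hext X h y)%E.

(* Main.v *)
Require Import Defs.
From HB Require Import structures.
From mathcomp Require Import all_boot all_order all_algebra.
From mathcomp Require Import all_classical all_reals all_analysis.
From mathcomp Require Import ring lra.
Import Order.TTheory GRing.Theory Num.Theory.
Import numFieldNormedType.Exports.
Local Open Scope classical_set_scope.
Local Open Scope ring_scope.

(** Everything reduces to one inequality per step.  The iterate [x_(k+1)]
    minimises [f + D_h(., x_k) / eta_k] over [X] and lies in the relative
    interior, so the one-sided derivative of this objective at [x_(k+1)] in the
    direction [xs - x_(k+1)] is nonnegative ([prox_optimality]):

      [0 <= <grad f(x_(k+1)), xs - x_(k+1)>
            + <grad h(x_(k+1)) - grad h(x_k), xs - x_(k+1)> / eta_k].

    Relative strong convexity at [x_(k+1)], together with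
    [f xs <= f x_(k+1)], bounds the first inner product above by
    [- mu * D_h(xs, x_(k+1))].  The three-point identity turns the second one
    into [D_h(xs, x_k) - D_h(xs, x_(k+1)) - D_h(x_(k+1), x_k)], and the step
    inequality follows ([prox_step]).  Convexity of [h] makes
    [D_h(x_(k+1), x_k)] nonnegative ([bregman_ge0]), so that the distances to
    [xs] contract; strong convexity of [h] gives
    [D_h(xs, x_k) >= s / 2 * |xs - x_k|^2] ([strongly_convex_bregman_ge]), which
    transfers the linear rate to the norm with ratio [sqrt q].

    The analytic input is always the same: a relative gradient at a relative
    interior point [u] computes the right derivative at [u] of the function
    along the segment towards any point of [X], boundary points included,
    because the beginning of that segment stays in [ri X] ([seg_near_ri],
    [rgrad_right_derivative]).  The optimality condition and the two lower bounds
    on [D_h] are each obtained by dividing an inequality along the segment by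
    [t] and letting [t] tend to 0 from the right.

    The point [xs] may lie on the relative boundary; finiteness of
    [D_h(xs, x_0)] means that [h] has a finite extended value at [xs], after
    which all the distances to [xs] are real numbers. *)

Set Implicit Arguments.
Unset Strict Implicit.

(** * The Euclidean inner product and norm *)

Section Euclidean.
Context (R : realType) (n : nat).
Implicit Types u v w : 'rV[R]_n.

Lemma dotDr u v w : dot u (v + w) = dot u v + dot u w.
Proof.
by rewrite /dot -big_split /=; apply: eq_bigr => i _; rewrite mxE mulrDr.
Qed.

Lemma dotZr (t : R) u v : dot u (t *: v) = t * dot u v.
Proof.
by rewrite /dot big_distrr /=; apply: eq_bigr => i _; rewrite mxE mulrCA.
Qed.

Lemma dotZl (t : R) u v : dot (t *: u) v = t * dot u v.
Proof.
by rewrite /dot big_distrr /=; apply: eq_bigr => i _; rewrite mxE mulrA.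
Qed.

Lemma enorm_ge0 u : 0 <= enorm u.
Proof. exact: sqrtr_ge0. Qed.

Lemma enormZ (t : R) u : 0 <= t -> enorm (t *: u) = t * enorm u.
Proof.
move=> t0; rewrite /enorm dotZl dotZr mulrA -expr2 sqrtrM ?sqr_ge0//.
by rewrite sqrtr_sqr ger0_norm.
Qed.

Lemma enormB u v : enorm (u - v) = enorm (v - u).
Proof.
by rewrite -opprB -scaleN1r /enorm dotZl dotZr !mulN1r opprK.
Qed.

End Euclidean.

(** * Relative gradients along segments *)

Section RelativeInterior.
Context (R : realType) (n : nat) (X : set 'rV[R]_n).
Implicit Types (u v g : 'rV[R]_n) (phi : 'rV[R]_n -> R).

Definition seg u v (t : R) : 'rV[R]_n := t *: v + (1 - t) *: u.

Lemma segB u v t : seg u v t - u = t *: (v - u).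
Proof. by rewrite /seg scalerBl scale1r scalerBr addrA addrAC addrK. Qed.

Lemma sub_aff v : X v -> aff X v.
Proof. by move=> Xv A [_]; apply. Qed.

Lemma aff_seg u v t : aff X u -> aff X v -> aff X (seg u v t).
Proof.
by move=> Xu Xv A AX; have [Aaff _] := AX; apply: Aaff; [exact: Xv|exact: Xu].
Qed.

Lemma ri_sub v : ri X v -> X v.
Proof. by move=> [affv nv]; exact: (nbhs_singleton nv). Qed.

Lemma cvg_seg u v : seg u v t @[t --> 0^'+] --> u.
Proof.
suff : seg u v t @[t --> 0^'+] --> 0 *: v + (1 - 0) *: u.
  by rewrite scale0r add0r subr0 scale1r.
apply: cvg_within_filter.
apply: cvgD; first by apply: cvgZr_tmp; exact: cvg_id.
by apply: cvgZr_tmp; apply: cvgB; [exact: cvg_cst|exact: cvg_id].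
Qed.

(** [ri X] is open in the affine hull of [X], and the segment does not leave
    that hull. *)
Lemma seg_near_ri u v : ri X u -> X v -> \forall t \near 0^'+, ri X (seg u v t).
Proof.
move=> [affu nu] Xv.
have : \forall t \near 0^'+, [set y | aff X y -> X y]° (seg u v t).
  exact: (@cvg_seg u v _ (nbhs_interior nu)).
apply: filterS => t /= nt; split=> //.
by apply: aff_seg => //; exact: sub_aff.
Qed.

(** Homogeneity of the Frechet remainder: along the segment it is at most
    [e * t * |v - u|], so that dividing by [t] leaves an arbitrarily small
    error. *)
Lemma rgrad_right_derivative phi u v g : ri X u -> X v -> is_rgrad X phi u g ->
  (phi (seg u v t) - phi u) / t @[t --> 0^'+] --> dot g (v - u).
Proof.
move=> riu Xv [_ phig]; apply/cvgrPdist_le => e e0.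
have N0 : 0 < enorm (v - u) + 1 by rewrite ltr_wpDl// enorm_ge0.
have e'0 : 0 < e / (enorm (v - u) + 1) by rewrite divr_gt0.
have := @cvg_seg u v _ (phig _ e'0).
rewrite /= => near_rem.
near=> t.
have t0 : 0 < t by near: t; exact: nbhs_right_gt.
have riut : ri X (seg u v t) by near: t; exact: seg_near_ri.
have : ri X (seg u v t) ->
    `|phi (seg u v t) - phi u - dot g (seg u v t - u)|
      <= e / (enorm (v - u) + 1) * enorm (seg u v t - u).
  by near: t.
move=> /(_ riut); rewrite segB dotZr (enormZ _ (ltW t0)) => rem.
have -> : dot g (v - u) - (phi (seg u v t) - phi u) / t
    = - ((phi (seg u v t) - phi u - t * dot g (v - u)) / t).
  by field; rewrite gt_eqF.
rewrite normrN normrM normfV (gtr0_norm t0) ler_pdivrMr//; apply: (le_trans rem).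
rewrite mulrCA mulrC ler_pM2r// mulrAC ler_pdivrMr// ler_pM2l//.
by rewrite lerDl.
Unshelve. all: by end_near. Qed.

Lemma rgradP phi u : rdifferentiable X phi u -> is_rgrad X phi u (rgrad X phi u).
Proof. by move=> [g phig]; exact: (xgetPex 0 (ex_intro _ g phig)). Qed.

End RelativeInterior.

(** * Lower bounds on the Bregman distance *)

Section Bregman.
Context (R : realType) (n : nat) (X : set 'rV[R]_n) (h : 'rV[R]_n -> R).
Implicit Types u v w : 'rV[R]_n.

Lemma hext_ri v : ri X v -> hext X h v = (h v)%:E.
Proof. by move=> riv; rewrite /hext mem_set. Qed.

Lemma hext_fin v u : (bregman X h v u < +oo)%E ->
  exists c, hext X h v = c%:E.
Proof.
by rewrite /bregman /hext; case: ifP => _; last case: ifP => _ //; eexists.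
Qed.

Lemma bregman_fin v u c : hext X h v = c%:E ->
  bregman X h v u = (c - (h u + dot (rgrad X h u) (v - u)))%:E.
Proof. by rewrite /bregman => ->; rewrite EFinB. Qed.

(** Letting [t] tend to 0 in the difference quotient of [h] along the segment
    from [u] to [v].  Convexity is the case [s = 0]; for strong convexity [s] is
    the quadratic gain.  The real [c] stands for the extended value of [h] at
    [v], which the segment does not see when [v] is a boundary point. *)
Lemma bregman_lower_bound u v (c s : R) : ri X u -> X v ->
  rdifferentiable X h u ->
  (forall t : R, 0 < t < 1 -> ri X (seg u v t) ->
     h (seg u v t) + s * t * (1 - t) <= t * c + (1 - t) * h u) ->
  s <= c - (h u + dot (rgrad X h u) (v - u)).
Proof.
move=> riu Xv hu hseg.
suff : dot (rgrad X h u) (v - u) + s * (1 - 0) <= c - h u by lra.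
have lim : (h (seg u v t) - h u) / t + s * (1 - t) @[t --> 0^'+]
    --> dot (rgrad X h u) (v - u) + s * (1 - 0).
  apply: cvgD; first exact: rgrad_right_derivative (rgradP _).
  apply: cvgMl_tmp; apply: cvgB; first exact: cvg_cst.
  by apply: cvg_within_filter; exact: cvg_id.
apply: (cvgr_to_le lim).
near=> t.
have t0 : 0 < t by near: t; exact: nbhs_right_gt.
have t1 : t < 1 by near: t; exact: nbhs_right_lt.
have riut : ri X (seg u v t) by near: t; exact: seg_near_ri.
have := hseg t; rewrite t0 t1 => /(_ isT riut) le_t.
rewrite -(ler_pM2r t0) mulrDl divfK ?gt_eqF//; lra.
Unshelve. all: by end_near. Qed.

Lemma bregman_ge0 u v : strictly_convex_on (ri X) h -> ri X u -> ri X v ->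
  rdifferentiable X h u -> (0 <= bregman X h v u)%E.
Proof.
move=> hconv riu riv hu.
rewrite (bregman_fin _ (hext_ri riv)) lee_fin.
apply: bregman_lower_bound => //; first exact: ri_sub.
move=> t t01 _; rewrite !mul0r addr0.
have [->|vu] := eqVneq v u; last exact: ltW (hconv _ _ _ riv riu vu t01).
by rewrite /seg -scalerDl -mulrDl addrC subrK scale1r mul1r.
Qed.

(** Used with [v] the minimiser, which may be a boundary point: the strong
    convexity inequality then reads [h] near [u] only, apart from the finite
    value [c], so the derivative at [u] suffices. *)
Lemma strongly_convex_bregman_ge u v (c s : R) : ri X u -> X v ->
  rdifferentiable X h u -> hext X h v = c%:E ->
  (forall t : R, 0 <= t <= 1 ->
     (hext X h (t *: v + (1 - t) *: u)
        + (s / 2 * t * (1 - t) * enorm (v - u) ^+ 2)%:E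
      <= t%:E * hext X h v + (1 - t)%:E * hext X h u)%E) ->
  s / 2 * enorm (v - u) ^+ 2 <= c - (h u + dot (rgrad X h u) (v - u)).
Proof.
move=> riu Xv hu hv hs; apply: bregman_lower_bound => // t /andP[t0 t1] riut.
have := hs t; rewrite (ltW t0) (ltW t1) => /(_ isT).
rewrite -/(seg u v t) (hext_ri riut) hv (hext_ri riu).
rewrite -!EFinM -!EFinD lee_fin; lra.
Qed.

End Bregman.

(** * One Bregman proximal step *)

Section ProximalStep.
Context (R : realType) (n : nat) (X : set 'rV[R]_n) (h f : 'rV[R]_n -> R).
Context (mu eta : R) (y p xs : 'rV[R]_n).
Hypotheses (eta_gt0 : 0 < eta) (rip : ri X p).
Hypotheses (f_diff : rdifferentiable X f p) (h_diff : rdifferentiable X h p).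
Hypothesis p_argmin :
  argmin X (fun u => ((f u)%:E + eta^-1%:E * bregman X h u y)%E) p.

(** First-order optimality in the proximal subproblem.  At the points of the
    segment from [p] to [v] close to [p], [D_h(., y)] involves [h] itself and
    not its extension, so its right derivative at [p] is
    [<grad h(p) - grad h(y), v - p>] even when [v] is a boundary point. *)
Lemma prox_optimality v : X v ->
  0 <= dot (rgrad X f p) (v - p)
       + eta^-1 * (dot (rgrad X h p) (v - p) - dot (rgrad X h y) (v - p)).
Proof.
move=> Xv; have [_ pmin] := p_argmin.
have lim : (f (seg p v t) - f p) / t
    + eta^-1 * ((h (seg p v t) - h p) / t - dot (rgrad X h y) (v - p))
    @[t --> 0^'+] --> dot (rgrad X f p) (v - p)
       + eta^-1 * (dot (rgrad X h p) (v - p) - dot (rgrad X h y) (v - p)).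
  apply: cvgD; first exact: rgrad_right_derivative (rgradP _).
  apply: cvgMl_tmp; apply: cvgB; last exact: cvg_cst.
  exact: rgrad_right_derivative (rgradP _).
apply: (cvgr_to_ge lim).
near=> t.
have t0 : 0 < t by near: t; exact: nbhs_right_gt.
have riut : ri X (seg p v t) by near: t; exact: seg_near_ri.
have := pmin _ (ri_sub riut).
rewrite !(bregman_fin _ (hext_ri h rip)).
rewrite !(bregman_fin _ (hext_ri h riut)).
rewrite -!EFinM -!EFinD lee_fin.
have -> : seg p v t - y = t *: (v - p) + (p - y) by rewrite -segB addrA subrK.
rewrite (dotDr _ (t *: _)) dotZr => le_t.
rewrite -(ler_pM2r t0) mul0r mulrDl divfK ?gt_eqF// -mulrA mulrBl divfK ?gt_eqF//.
lra.
Unshelve. all: by end_near. Qed.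

Hypothesis xs_argmin : argmin X f xs.
Hypothesis f_rel_strong :
  ((f p + dot (rgrad X f p) (xs - p))%:E + mu%:E * bregman X h xs p
     <= (f xs)%:E)%E.

Lemma prox_step : (bregman X h xs y < +oo)%E ->
  ((1 + eta * mu)%:E * bregman X h xs p + bregman X h p y
     <= bregman X h xs y)%E.
Proof.
move=> /hext_fin[c hxs]; have [Xxs fmin] := xs_argmin.
have opt := prox_optimality Xxs.
have fle : f xs <= f p by have := fmin _ (ri_sub rip).
move: f_rel_strong; rewrite !(bregman_fin _ hxs).
rewrite (bregman_fin _ (hext_ri h rip)).
rewrite -!EFinM -!EFinD !lee_fin => strong.
(* splitting [xs - y] at [p] is the three-point identity *)
have -> : xs - y = (xs - p) + (p - y) by rewrite addrA subrK.
rewrite (dotDr _ (xs - p)).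
set a := dot _ _ in opt strong; set b := dot _ (xs - p) in opt strong *.
set d := dot _ (xs - p) in opt *.
have {}opt : 0 <= eta * a + (b - d).
  have := mulr_ge0 (ltW eta_gt0) opt.
  by rewrite mulrDr mulrA divff ?gt_eqF// mul1r.
have {}strong : eta * (a + mu * (c - (h p + b))) <= 0.
  by rewrite pmulr_rle0//; lra.
lra.
Qed.

End ProximalStep.

Unset Implicit Arguments.
Set Strict Implicit.

(** * Linear convergence *)

Theorem theorem7p4 (R : realType) (n : nat) (X : set 'rV[R]_n)
    (h f : 'rV[R]_n -> R) (mu : R) (xs : 'rV[R]_n)
    (eta : nat -> R) (x : nat -> 'rV[R]_n)
    (X_neq0 : X !=set0) (X_closed : closed X) (X_convex : convex_set X)
    (h_C2 : relC2 X h) (h_legendre : legendre X h)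
    (f_diff : forall y, ri X y -> rdifferentiable X f y)
    (mu_gt0 : 0 < mu)
    (f_rel_strong : forall u v, ri X u -> X v ->
       ((f u + dot (rgrad X f u) (v - u))%:E + mu%:E * bregman X h v u
          <= (f v)%:E)%E)
    (xs_argmin : argmin X f xs)
    (x_ri : forall k, ri X (x k))
    (D0_fin : (bregman X h xs (x 0%N) < +oo)%E)
    (eta_gt0 : forall k, 0 < eta k)
    (x_step : forall k,
       argmin X (fun u => ((f u)%:E + (eta k)^-1%:E * bregman X h u (x k))%E)
         (x k.+1)) :
  [/\ (forall k,
         ((1 + eta k * mu)%:E * bregman X h xs (x k.+1)
            + bregman X h (x k.+1) (x k) <= bregman X h xs (x k))%E),
      (forall K : nat,
         (bregman X h xs (x K.+1)
            <= (\prod_(k < K.+1) (1 + eta k * mu)^-1)%:E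
                 * bregman X h xs (x 0%N))%E),
      (forall eta0 : R, (forall k, eta k = eta0) ->
         let q := (1 + eta0 * mu)^-1 in
         [/\ 0 < q < 1,
             (forall k, (bregman X h xs (x k.+1)
                           <= q%:E * bregman X h xs (x k))%E)
           & (forall k, (bregman X h xs (x k)
                           <= (q ^+ k)%:E * bregman X h xs (x 0%N))%E)])
    & (forall (eta0 : R) (U : set 'rV[R]_n), (forall k, eta k = eta0) ->
         convex_set U -> U `<=` X -> U xs -> (forall k, U (x k)) ->
         strongly_convex_on X h U ->
         exists C rho : R, [/\ 0 <= C, 0 < rho < 1 &
           forall k, enorm (x k - xs) <= C * rho ^+ k])].
Proof.
have h_diff k : rdifferentiable X h (x k) by apply: h_C2.1.
have [c hxs] := hext_fin D0_fin.
have fin k : (bregman X h xs (x k) < +oo)%E.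
  by rewrite (bregman_fin _ hxs) ltry.
have [Xxs _] := xs_argmin.
have step k : ((1 + eta k * mu)%:E * bregman X h xs (x k.+1)
    + bregman X h (x k.+1) (x k) <= bregman X h xs (x k))%E.
  by apply: (prox_step (f := f)); auto.
have fac_gt0 k : 0 < 1 + eta k * mu by rewrite addr_gt0// mulr_gt0.
(* discarding [D_h(x_(k+1), x_k) >= 0] in the step inequality *)
have contract k : (bregman X h xs (x k.+1)
    <= (1 + eta k * mu)^-1%:E * bregman X h xs (x k))%E.
  have := bregman_ge0 h_legendre.1 (x_ri k) (x_ri k.+1) (h_diff k).
  have := step k; rewrite !(bregman_fin _ hxs).
  rewrite (bregman_fin _ (hext_ri h (x_ri k.+1))).
  rewrite -!EFinM -!EFinD !lee_fin => le_k ge0.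
  by rewrite mulrC ler_pdivlMr//; lra.
have rate (eta0 : R) : (forall k, eta k = eta0) -> forall k,
    (bregman X h xs (x k)
       <= ((1 + eta0 * mu)^-1 ^+ k)%:E * bregman X h xs (x 0%N))%E.
  move=> etaE; elim=> [|k IHk]; first by rewrite expr0 mul1e.
  apply: (le_trans (contract k)); rewrite etaE exprS EFinM -muleA.
  by apply: lee_wpmul2l => //; rewrite lee_fin invr_ge0 ltW// -(etaE k).
have q01 (eta0 : R) : (forall k, eta k = eta0) -> 0 < (1 + eta0 * mu)^-1 < 1.
  move=> etaE; rewrite invr_gt0 -(etaE 0%N) fac_gt0 invf_lt1//.
  by rewrite ltrDl mulr_gt0.
split=> //.
- elim=> [|K IHK]; first by rewrite big_ord1; exact: contract.
  apply: (le_trans (contract K.+1)).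
  rewrite big_ord_recr/= (mulrC (\prod_(_ < _) _)) EFinM -muleA.
  by apply: lee_wpmul2l => //; rewrite lee_fin invr_ge0 ltW.
- move=> eta0 etaE q; split; [exact: q01|move=> k|exact: rate].
  by have := contract k; rewrite etaE.
- move=> eta0 U etaE _ _ Uxs Ux [s s0 hs].
  have /andP[q0 q1] := q01 _ etaE; have := rate _ etaE.
  set q := (1 + eta0 * mu)^-1 in q0 q1 *.
  rewrite (bregman_fin _ hxs).
  set D0 := c - (h (x 0%N) + _) => rateD.
  have quad k : s / 2 * enorm (xs - x k) ^+ 2
      <= c - (h (x k) + dot (rgrad X h (x k)) (xs - x k)).
    by apply: strongly_convex_bregman_ge => // t t01; exact: hs.
  have D0_ge0 : 0 <= D0.
    by apply: le_trans (quad 0%N); rewrite mulr_ge0 ?sqr_ge0// divr_ge0// ltW.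
  have s2 : 0 <= 2 / s * D0 by rewrite mulr_ge0// divr_ge0// ltW.
  exists (Num.sqrt (2 / s * D0)), (Num.sqrt q); split.
  + exact: sqrtr_ge0.
  + by rewrite sqrtr_gt0 q0 -sqrtr1 ltr_sqrt.
  move=> k; have C_ge0 : 0 <= Num.sqrt (2 / s * D0) * Num.sqrt q ^+ k.
    by rewrite mulr_ge0 ?exprn_ge0 ?sqrtr_ge0.
  rewrite enormB -(@ler_pXn2r _ 2) ?nnegrE ?enorm_ge0//.
  rewrite exprMn (sqr_sqrtr s2) exprAC (sqr_sqrtr (ltW q0)).
  have := rateD k; rewrite (bregman_fin _ hxs) -EFinM lee_fin => rk.
  have -> : enorm (xs - x k) ^+ 2 = 2 / s * (s / 2 * enorm (xs - x k) ^+ 2).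
    by field; rewrite gt_eqF.
  rewrite -[_ * D0 * _]mulrA ler_wpM2l ?divr_ge0 ?(ltW s0)// [D0 * _]mulrC.
  exact: le_trans (quad k) rk.
Qed.
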